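(* Let $\pi,\tau\in\mathfrak{S}_m$ be in standard form. If $\pi$ and $\tau$ are strongly c-Wilf equivalent, then $\pi_m-\pi_1=\tau_m-\tau_1$.
   Context: $\mathfrak{S}_n$ is the symmetric group on $[n]$, permutations written $\sigma=\sigma_1\cdots\sigma_n$. The standardization $\operatorname{st}(w)$ of a word of distinct integers replaces its smallest entry by 1, the next smallest by 2, etc. For $\pi\in\mathfrak{S}_m$ and $\sigma\in\mathfrak{S}_n$, $\operatorname{Em}(\pi,\sigma)=\{i\in[n-m+1]:\operatorname{st}(\sigma_i\cdots\sigma_{i+m-1})=\pi\}$. Let $a^\pi_{n,k}$ be the number of $\sigma\in\mathfrak{S}_n$ with $|\operatorname{Em}(\pi,\sigma)|=k$. $\pi$ and $\tau$ are strongly c-Wilf equivalent if $a^\pi_{n,k}=a^\tau_{n,k}$ for all $n,k$. A permutation $\pi\in\mathfrak{S}_m$ is in standard form if $\pi_1<\pi_m$ and $\pi_1+\pi_m\le m+1$. *)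

(* Defs.v *)
From mathcomp Require Import all_boot all_fingroup.
Set Implicit Arguments. Unset Strict Implicit. Unset Printing Implicit Defensive.

(* Permutations of [n] are modelled as 'S_n = {perm 'I_n}; position i (1-based)
   is the ordinal i-1 and value v (1-based) is the ordinal v-1.  The shift by one
   is uniform, so comparisons and differences are unchanged. *)

(* value of sigma at (0-based) position p, as a nat; 0 if out of range (unused) *)
Definition pval n (s : 'S_n) (p : nat) : nat :=
  match insub p with Some i => val (s i) | None => 0 end.

(* standardization of the window sigma_i ... sigma_{i+m-1} (0-based start i):
   entry j is the number of window entries smaller than the j-th one,
   i.e. the 0-based rank (so entries are 0..m-1, matching 'S_m values). *)
Definition st_window n m (s : 'S_n) (i : nat) (j : 'I_m) : nat :=
  #|[set k : 'I_m | pval s (i + k) < pval s (i + j)]|.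

Definition Em m n (pi : 'S_m) (s : 'S_n) : {set 'I_n.+1} :=
  [set i : 'I_n.+1 | (i + m <= n) &&
     [forall j : 'I_m, st_window s i j == val (pi j)]].

Definition a_count m (pi : 'S_m) (n k : nat) : nat :=
  #|[set s : 'S_n | #|Em pi s| == k]|.

Definition strongly_cWilf_equiv m (pi tau : 'S_m) : Prop :=
  forall n k, a_count pi n k = a_count tau n k.

(* standard form: pi_1 < pi_m and pi_1 + pi_m <= m + 1 (1-based values);
   with 0-based values v = pi_j - 1 this reads v_1 < v_m, v_1 + v_m + 2 <= m + 1. *)
Definition standard_form m (pi : 'S_m.+1) : Prop :=
  (val (pi ord0) < val (pi ord_max)) /\
  (val (pi ord0) + val (pi ord_max) + 2 <= m.+1 + 1).

(* Main.v *)
From mathcomp Require Import all_boot all_fingroup all_algebra zify ring.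
Require Import Defs.
Set Implicit Arguments. Unset Strict Implicit. Unset Printing Implicit Defensive.

(** Let the pattern have length [m + 1].  By inclusion-exclusion, the numbers
    [a_count] determine, for all [n], the sum [Wpoly n] of ['X^#|S|] times the
    probability that a uniform permutation of [n] letters has occurrences at all
    the marked positions [S].  Cutting a marked permutation at the first boundary
    straddled by no marked occurrence gives
    [Wpoly n = \sum_(1 <= r < n.+1) Ipoly r * Wpoly (n - r)], so that the
    contribution [Ipoly] of the irreducible markings (the clusters) is determined
    as well.  On [k * m + 1] letters there is only one irreducible marking with
    [k] marks, the one whose consecutive occurrences share a single letter.
    Hence equivalent patterns have the same number [e_k] of permutations of
    [k * m + 1] letters with occurrences at [0, m, 2m, ..., (k - 1) m].

    If [d] is the difference between the last and the first entry of the pattern,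
    such a permutation contains a chain of [k * d + 1] letters whose relative order
    is forced, so [e_k <= (k * m + 1) ^ (k * (m - d))].  Conversely, each of the
    remaining [k * (m - d)] letters lies below or above the whole part of the chain
    inside its own occurrence, and choosing its height relative to the chain freely
    in a suitable window shows that [e_k] is at least [k ^ (k * (m - d))]
    up to a factor exponential in [k].  The growth of [e_k] thus determines
    [d]. *)

(** * Marked words and standardization *)

(** A marking is a bit sequence with [true] at the marked positions; the default [false] makes every
    position beyond its end unmarked. *)
Definition marks_in (e : pred nat) (b : bitseq) :=
  all (fun i => nth false b i ==> e i) (iota 0 (size b)).

Lemma marks_inP (e : pred nat) b :
  reflect (forall i, nth false b i -> e i) (marks_in e b).
Proof.
apply: (iffP allP) => [H i bi|H i _]; last by apply/implyP/H.
have lt_i : i < size b by case: ltnP bi => // /(nth_default false) ->.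
by move: (H i); rewrite mem_iota bi; apply.
Qed.

Section Words.
Variables (m : nat) (pi : 'S_m.+1).
Implicit Types (u v : seq nat) (b : bitseq).

(** Pairwise comparisons instead of ranks make invariance under strictly monotone relabelling
    immediate. *)
Definition occ u i : bool :=
  (i + m < size u) &&
  [forall j : 'I_m.+1, forall k : 'I_m.+1,
     (nth 0 u (i + j) < nth 0 u (i + k)) == (pi j < pi k)].

Definition sat b u := marks_in (occ u) b.

Definition cnt b := count (sat b) (permutations (iota 0 (size b))).

Lemma occP u i :
  reflect (i + m < size u /\ forall j k : 'I_m.+1,
             (nth 0 u (i + j) < nth 0 u (i + k)) = (pi j < pi k)) (occ u i).
Proof.
apply: (iffP andP) => -[lt_i H]; split=> //.
  by move=> j k; move/forallP/(_ j)/forallP/(_ k)/eqP: H.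
by apply/forallP=> j; apply/forallP=> k; rewrite H.
Qed.

Lemma occ_map f u i :
  {in u &, {mono f : x y / x < y}} -> occ (map f u) i = occ u i.
Proof.
move=> mono_f; rewrite /occ size_map; case: ltnP => //= lt_i.
apply: eq_forallb => j; apply: eq_forallb => k.
have lt_ik (l : 'I_m.+1) : i + l < size u by have := ltn_ord l; lia.
by rewrite !(nth_map 0) // mono_f // mem_nth.
Qed.

Lemma occ_catl u v i : i + m < size u -> occ (u ++ v) i = occ u i.
Proof.
move=> lt_i; rewrite /occ size_cat lt_i (leq_trans lt_i) ?leq_addr //=.
apply: eq_forallb => j; apply: eq_forallb => k.
have lt_ik (l : 'I_m.+1) : i + l < size u by have := ltn_ord l; lia.
by rewrite !nth_cat !lt_ik.
Qed.

Lemma occ_catr u v i : occ (u ++ v) (size u + i) = occ v i.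
Proof.
rewrite /occ size_cat -addnA ltn_add2l; congr andb.
apply: eq_forallb => j; apply: eq_forallb => k.
by rewrite -!addnA !nth_cat !ltnNge !leq_addr /= !addKn.
Qed.

Lemma sat_map f b u :
  {in u &, {mono f : x y / x < y}} -> sat b (map f u) = sat b u.
Proof. by move=> mono_f; apply: eq_all => i; rewrite occ_map. Qed.

(* No marked occurrence straddles the boundary between positions [r - 1] and [r]. *)
Definition brk b r := marks_in (fun i => (i + m < r) || (r <= i)) b.

Lemma brkP b r :
  reflect (forall i, nth false b i -> (i + m < r) || (r <= i)) (brk b r).
Proof. exact: marks_inP. Qed.

Lemma satP b u : reflect (forall i, nth false b i -> occ u i) (sat b u).
Proof. exact: marks_inP. Qed.

(** No marked window of [b1] reaches past the boundary, so each marked window lies inside [u1] or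
    inside [u2]. *)
Lemma sat_cat b1 b2 u1 u2 : size u1 = size b1 -> brk b1 (size b1) ->
  sat (b1 ++ b2) (u1 ++ u2) = sat b1 u1 && sat b2 u2.
Proof.
move=> eq_sz /brkP br; apply/satP/andP=> [H|[/satP H1 /satP H2] i].
  split; apply/satP => i bi.
    have lt_i : i < size b1 by case: ltnP bi => // /(nth_default false) ->.
    have := H i; rewrite nth_cat lt_i => /(_ bi); rewrite occ_catl // eq_sz.
    by move: (br i bi); lia.
  have := H (size b1 + i); rewrite nth_cat ltnNge leq_addr /= addKn => /(_ bi).
  by rewrite -eq_sz occ_catr.
rewrite nth_cat; case: ltnP => [lt_i bi|le_i bi].
  by rewrite occ_catl ?H1 // eq_sz; move: (br i bi); lia.
by rewrite -(subnKC le_i) -eq_sz occ_catr eq_sz H2.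
Qed.

Lemma sat_brk b u : size u = size b -> sat b u -> brk b (size b).
Proof.
move=> eq_sz /satP H; apply/brkP=> i /H /occP[]; rewrite eq_sz => ->.
by [].
Qed.

End Words.

(** * Standardization of words *)

Section Standardization.
Implicit Types s u : seq nat.

(** Mapping [rk s] over a duplicate-free [s] standardizes it, with letters starting at 0. *)
Definition rk s x := count (fun y => y < x) s.

Lemma ltn_rk s : {in s &, {mono rk s : x y / x < y}}.
Proof.
have rk_lt x y : x \in s -> x < y -> rk s x < rk s y.
  move=> xs lt_xy; rewrite /rk.
  have -> : count (fun z => z < y) s =
    count (fun z => z < x) s + count (fun z => x <= z < y) s.
    rewrite -count_predUI (eq_count (a2 := fun z => z < y)) => [|z] /=; last lia.
    by rewrite (@eq_count _ (predI _ _) pred0) ?count_pred0 ?addn0 // => z /=; lia.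
  rewrite -[X in X < _]addn0 ltn_add2l -has_count.
  by apply/hasP; exists x => //; rewrite leqnn.
move=> x y xs ys; case: (ltngtP x y) => [lt|gt|->]; last by rewrite ltnn.
  by rewrite rk_lt.
by apply/negbTE; rewrite -leqNgt ltnW // rk_lt.
Qed.

Lemma rk_inj s : {in s &, injective (rk s)}.
Proof.
move=> x y xs ys eq_xy; have := ltn_rk xs ys; have := ltn_rk ys xs.
by rewrite eq_xy ltnn; lia.
Qed.

Lemma perm_rk s : uniq s -> perm_eq (map (rk s) s) (iota 0 (size s)).
Proof.
move=> us; have u_map : uniq (map (rk s) s).
  by rewrite map_inj_in_uniq //; apply: rk_inj.
apply: uniq_perm => //; first exact: iota_uniq.
have [||] := @uniq_min_size _ _ (iota 0 (size s)) u_map => //.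
  move=> _ /mapP[x xs ->]; rewrite mem_iota /=.
  rewrite -(count_predC (fun y => y < x) s) -[X in X < _]addn0 ltn_add2l -has_count.
  by apply/hasP; exists x; rewrite //= ltnn.
by rewrite size_iota size_map.
Qed.

Lemma permutations_map (f : nat -> nat) s : uniq s -> {in s &, injective f} ->
  perm_eq (map (map f) (permutations s)) (permutations (map f s)).
Proof.
move=> us injf.
have inj_map : {in permutations s &, injective (map f)}.
  move=> u v; rewrite !mem_permutations => pu pv eq_uv.
  apply: (inj_in_map injf) eq_uv.
  - by rewrite inE; apply/allP=> x; rewrite (perm_mem pu).
  - by rewrite inE; apply/allP=> x; rewrite (perm_mem pv).
have u_map : uniq (map (map f) (permutations s)).
  by rewrite map_inj_in_uniq ?permutations_uniq.
apply: uniq_perm => //; first exact: permutations_uniq.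
have [||] := @uniq_min_size _ _ (permutations (map f s)) u_map => //.
  move=> _ /mapP[v pv ->]; move: pv; rewrite !mem_permutations.
  exact: perm_map.
by rewrite size_map !size_permutations ?map_inj_in_uniq // size_map.
Qed.

End Standardization.

(** * Independence of the two sides of an unstraddled boundary *)

Section Counting.
Variables (m : nat) (pi : 'S_m.+1).
Implicit Types (u v s : seq nat) (b : bitseq).

Lemma count_sat_permutations b s : uniq s -> size s = size b ->
  count (sat pi b) (permutations s) = cnt pi b.
Proof.
move=> us eq_sz; rewrite /cnt -eq_sz.
have /seq.permP <- := perm_permutations (perm_rk us).
have /seq.permP <- := permutations_map us (@rk_inj s).
rewrite count_map; apply: eq_in_count => u; rewrite mem_permutations => pu /=.
rewrite sat_map // => x y; rewrite !(perm_mem pu); exact: ltn_rk.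
Qed.

Definition same_blocks r u v :=
  perm_eq (take r u) (take r v) && perm_eq (drop r u) (drop r v).

Lemma perm_block_class r s u : uniq s -> r <= size s -> perm_eq u s ->
  perm_eq [seq v <- permutations s | same_blocks r v u]
    [seq v ++ w | v <- permutations (take r u), w <- permutations (drop r u)].
Proof.
move=> us le_r pu; have szu := perm_size pu.
have sz_v v : v \in permutations (take r u) -> size v = size (take r u).
  by rewrite mem_permutations => /perm_size.
apply: uniq_perm.
- by rewrite filter_uniq // permutations_uniq.
- apply: allpairs_uniq_dep => [|x _|]; rewrite ?permutations_uniq //.
  move=> [v w] [v' w'] /allpairsPdep[x [y [px py [-> ->]]]].
  move=> /allpairsPdep[x' [y' [px' py' [-> ->]]]] /= /eqP.
  rewrite eqseq_cat; last by rewrite (sz_v _ px) (sz_v _ px').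
  by case/andP=> /eqP -> /eqP ->.
move=> v; rewrite mem_filter mem_permutations.
apply/andP/allpairsPdep => [[/andP[p1 p2] pv]|[x [y [px py ->]]]].
  exists (take r v), (drop r v); rewrite !mem_permutations p1 p2.
  by rewrite cat_take_drop.
have sx := sz_v _ px; move: px py; rewrite !mem_permutations => px py.
split; last by rewrite -(permPr pu) -[X in perm_eq _ X](cat_take_drop r) perm_cat.
have sr : size x = r by rewrite sx size_takel // szu.
by rewrite /same_blocks -sr take_size_cat // drop_size_cat // sr px py.
Qed.

(* Averaging over the rearrangements inside each of the two blocks makes them
   independent. *)
Lemma cnt_cat b1 b2 : brk m b1 (size b1) ->
  cnt pi (b1 ++ b2) * ((size b1)`! * (size b2)`!) =
  (size b1 + size b2)`! * (cnt pi b1 * cnt pi b2).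
Proof.
move=> br; set r := size b1; set t := size b2.
set s := iota 0 (r + t); have us : uniq s by apply: iota_uniq.
have le_r : r <= size s by rewrite size_iota leq_addr.
have ps u : u \in permutations s -> [/\ size u = r + t, uniq u & perm_eq u s].
  rewrite mem_permutations => pu.
  by rewrite (perm_size pu) (perm_uniq pu) size_iota.
have sz12 u : u \in permutations s -> size (take r u) = r /\ size (drop r u) = t.
  by case/ps => su _ _; rewrite size_drop size_takel su ?addKn // leq_addr.
(* Double counting of pairs: each [v] has [r]! * [t]! partners [u], while for fixed [u] the words
   [v] range over a product of two sets of rearrangements. *)
transitivity (\sum_(u <- permutations s) \sum_(v <- permutations s)
   same_blocks r v u * sat pi (b1 ++ b2) v).
  rewrite exchange_big /= /cnt size_cat -/r -/t -/s -sumn_count.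
  rewrite sumnE big_map big_distrl /=.
  apply: eq_big_seq => v pv; rewrite -big_distrl /= mulnC; congr (_ * _).
  have [sv uv pvs] := ps _ pv; have [s1 s2] := sz12 _ pv.
  transitivity (count (fun u => same_blocks r u v) (permutations s)).
    rewrite -size_filter (perm_size (perm_block_class us le_r pvs)) size_allpairs.
    by rewrite !size_permutations ?take_uniq ?drop_uniq // s1 s2.
  rewrite -sum1_count big_mkcond; apply: eq_bigr => u _.
  by rewrite /same_blocks perm_sym [X in _ && X]perm_sym; case: ifP.
transitivity (\sum_(u <- permutations s) cnt pi b1 * cnt pi b2); last first.
  by rewrite big_const_seq count_predT iter_addn_0 mulnC size_permutations // size_iota.
apply: eq_big_seq => u pu.
have [su uu pus] := ps _ pu; have [s1 s2] := sz12 _ pu.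
rewrite -(count_sat_permutations (take_uniq r uu) s1).
rewrite -(count_sat_permutations (drop_uniq r uu) s2).
transitivity (\sum_(v <- [seq v <- permutations s | same_blocks r v u])
                 sat pi (b1 ++ b2) v).
  rewrite big_filter [RHS]big_mkcond; apply: eq_bigr => v _.
  by case: ifP; rewrite ?mul1n ?mul0n.
rewrite (perm_big _ (perm_block_class us le_r pus)) big_allpairs_dep /=.
rewrite -!sumn_count !sumnE !big_map big_distrl /=; apply: eq_big_seq => v pv.
rewrite big_distrr /=; apply: eq_bigr => w _.
rewrite sat_cat ?mulnb //; move: pv; rewrite mem_permutations => /perm_size ->.
by rewrite s1.
Qed.

End Counting.

(** * The cluster method *)

Section BitSequences.

Fixpoint bits n : seq bitseq :=
  if n is n'.+1 then map (cons false) (bits n') ++ map (cons true) (bits n')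
  else [:: [::]].

Lemma mem_bits n b : (b \in bits n) = (size b == n).
Proof.
elim: n b => [|n IH] [|c b] //=.
  by rewrite mem_cat; apply/norP; split; apply/mapP; case.
rewrite mem_cat eqSS -IH; apply/orP/idP.
  by case=> /mapP[x xb [_ ->]].
by move=> bb; case: c; [right | left]; apply: map_f.
Qed.

Lemma bits_uniq n : uniq (bits n).
Proof.
elim: n => //= n IH; have inj_cons c : injective (cons c : bitseq -> bitseq).
  by move=> x y [].
rewrite cat_uniq !map_inj_uniq // IH !andbT.
by apply/hasPn => x /mapP[y _ ->]; apply/mapP => -[].
Qed.

Lemma big_bits_cat (M : nmodType) r s (f : bitseq -> M) :
  (\sum_(b <- bits (r + s)) f b =
   \sum_(b1 <- bits r) \sum_(b2 <- bits s) f (b1 ++ b2))%R.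
Proof.
elim: r f => [|r IH] f /=; first by rewrite big_seq1.
by rewrite !big_cat !big_map /= !IH.
Qed.

Lemma marks_in_cons e c b :
  marks_in e (c :: b) = (c ==> e 0) && marks_in (e \o succn) b.
Proof.
by rewrite /marks_in /= -[1]/(1 + 0) iotaDl all_map.
Qed.

(** Each position where [e] holds may be marked or not and contributes [1 + 'X]; any other position
    must stay unmarked. This is the inclusion-exclusion step. *)
Lemma sum_marks_in n (e : pred nat) :
  (\sum_(b <- bits n | marks_in e b) 'X^(count id b) =
   (1 + 'X) ^+ count e (iota 0 n) :> {poly rat})%R.
Proof.
elim: n e => [|n IH] e /=; first by rewrite big_mkcond big_seq1 /= GRing.expr0.
rewrite big_cat !big_map /= -[1%N]/(1 + 0) iotaDl count_map GRing.exprD.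
rewrite -(IH (preim succn e)).
have E c b : marks_in e (c :: b) = (c ==> e 0) && marks_in (preim succn e) b.
  exact: marks_in_cons.
rewrite (eq_bigl _ _ (E false)) (eq_bigl _ _ (E true)) /=.
case: (e 0) => /=.
  rewrite GRing.mulrDl GRing.mul1r; congr (_ + _)%R.
  by rewrite GRing.mulr_sumr; apply: eq_bigr => b _; rewrite GRing.exprS.
by rewrite GRing.expr0 GRing.mul1r big_pred0_eq GRing.addr0.
Qed.

Lemma sum_first_true (P : pred nat) n :
  \sum_(1 <= r < n.+1) (P r && ~~ has P (iota 1 r.-1)) = has P (iota 1 n).
Proof.
elim: n => [|n IH]; first by rewrite big_geq.
have -> : iota 1 n.+1 = rcons (iota 1 n) n.+1.
  by rewrite -cats1 -[n.+1 in LHS]addn1 iotaD add1n.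
rewrite big_nat_recr //= IH has_rcons.
by case: (has _ _); case: (P _).
Qed.

End BitSequences.

Section ClusterMethod.
Variables (m : nat) (pi : 'S_m.+1).
Import GRing.Theory.
Local Open Scope ring_scope.

(** The coefficient is the probability of occurrences at all the marks; this normalization turns
    [cnt_cat] into multiplicativity. *)
Definition wt (b : bitseq) : {poly rat} :=
  ((cnt pi b)%:R / ((size b)`!)%:R) *: 'X^(count id b).

(** The clusters: all marked windows fit in the word, and every inner boundary is straddled by one
    of them. *)
Definition irr (b : bitseq) :=
  brk m b (size b) && ~~ has (brk m b) (iota 1 (size b).-1).

Definition Wpoly n := \sum_(b <- bits n) wt b.
Definition Ipoly n := \sum_(b <- bits n | irr b) wt b.

Lemma fact_neq0 n : (n`!)%:R != 0 :> rat.
Proof. by rewrite Num.Theory.pnatr_eq0 -lt0n fact_gt0. Qed.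

Lemma wt_cat b1 b2 : brk m b1 (size b1) -> wt (b1 ++ b2) = wt b1 * wt b2.
Proof.
move=> br; rewrite /wt count_cat exprD -scalerAl -scalerAr scalerA size_cat.
congr (_ *: _); apply: (canLR (mulfK (fact_neq0 _))).
have := congr1 (fun n => n%:R : rat) (cnt_cat pi b2 br); rewrite !natrM => E.
have n1 := fact_neq0 (size b1); have n2 := fact_neq0 (size b2).
apply: (mulIf (mulf_neq0 n1 n2)); rewrite E.
move: (_%:R) (_%:R) (_%:R) (_%:R) (_%:R) n1 n2 {E} => N c1 c2 f1 f2 n1 n2.
by field; rewrite n1 n2.
Qed.

Lemma brk_catl b1 b2 r : (r <= size b1)%N -> brk m (b1 ++ b2) r = brk m b1 r.
Proof.
move=> le_r; apply/brkP/brkP => H i.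
  move=> bi; apply: H; rewrite nth_cat; case: ltnP => // le_i.
  by rewrite nth_default in bi.
rewrite nth_cat; case: ltnP => [_|le_i _]; first exact: H.
by rewrite (leq_trans le_r le_i) orbT.
Qed.

Lemma wt_brk b : ~~ brk m b (size b) -> wt b = 0.
Proof.
move=> nb; rewrite /wt; suff -> : cnt pi b = 0%N by rewrite mul0r scale0r.
apply/eqP; rewrite -leqn0 leqNgt -has_count; apply/negP => /hasP[u].
rewrite mem_permutations => /perm_size; rewrite size_iota => su.
by move/(sat_brk su); apply/negP.
Qed.

Lemma Wpoly_rec n : (0 < n)%N ->
  Wpoly n = \sum_(1 <= r < n.+1) Ipoly r * Wpoly (n - r).
Proof.
move=> n_gt0; pose fst b r := brk m b r && ~~ has (brk m b) (iota 1 r.-1).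
transitivity (\sum_(1 <= r < n.+1) \sum_(b <- bits n | fst b r) wt b).
  under eq_bigr => r _ do rewrite big_mkcond.
  rewrite exchange_big /=; apply: eq_big_seq => b; rewrite mem_bits => /eqP sb.
  rewrite (eq_bigr (fun r => wt b *+ fst b r)) => [|r _]; last by case: ifP.
  (* The boundary [n] qualifies unless a marked window overruns the word, and then the weight is
     zero. *)
  rewrite sumrMnr sum_first_true; case: (boolP (brk m b n)) => [br|nbr].
    rewrite (_ : has _ _) // ; apply/hasP; exists n => //.
    by rewrite mem_iota; lia.
  by rewrite wt_brk ?sb // mul0rn.
rewrite big_nat_cond [RHS]big_nat_cond; apply: eq_bigr => r; rewrite andbT.
case/andP=> r_gt0 le_rn; rewrite -{1}(subnKC (le_rn : (r <= n)%N)).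
rewrite big_mkcond big_bits_cat /Ipoly mulr_suml [RHS]big_mkcond /=.
apply: eq_big_seq => b1; rewrite mem_bits => /eqP s1.
(* Whether [r] is the first free boundary depends on the first [r] bits only. *)
have E b2 : fst (b1 ++ b2) r = irr b1.
  rewrite /fst /irr s1 brk_catl ?s1 //; congr (_ && ~~ _).
  apply: eq_in_has => x; rewrite mem_iota => lt_x.
  by rewrite brk_catl // s1; lia.
under eq_bigr => b2 _ do rewrite E.
case: ifP => [/andP[br _]|_]; last by rewrite big1.
by rewrite mulr_sumr; apply: eq_bigr => b2 _; rewrite wt_cat.
Qed.

Lemma Wpoly0 : Wpoly 0 = 1.
Proof. by rewrite /Wpoly big_seq1 /wt /= divr1 expr0 scale1r. Qed.

Lemma Wpoly_occ n : (n`!)%:R *: Wpoly n =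
  \sum_(u <- permutations (iota 0 n)) (1 + 'X) ^+ count (occ pi u) (iota 0 n).
Proof.
under eq_bigr => u _ do rewrite -sum_marks_in big_mkcond.
rewrite exchange_big scaler_sumr; apply: eq_big_seq => b.
rewrite mem_bits => /eqP sb; rewrite -big_mkcond /=.
rewrite big_const_seq iter_addr_0 -scaler_nat /wt scalerA /cnt sb.
by rewrite mulrC divfK ?fact_neq0.
Qed.

End ClusterMethod.

(** As [Wpoly 0] is 1, the last term of the recurrence is [Ipoly n], and induction cancels the other
    terms. *)
Lemma eq_Ipoly m (pi tau : 'S_m.+1) :
  (forall n, Wpoly pi n = Wpoly tau n) -> forall n, 0 < n -> Ipoly pi n = Ipoly tau n.
Proof.
move=> eqW; elim/ltn_ind => n IH n_gt0.
have := eqW n; rewrite !Wpoly_rec // !(big_nat_recr n) //= subnn !Wpoly0 !GRing.mulr1.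
rewrite (eq_big_nat _ _ (F2 := fun r => (Ipoly tau r * Wpoly tau (n - r))%R)).
  exact: GRing.addrI.
by move=> r /andP[r_gt0 lt_rn]; rewrite IH ?eqW.
Qed.

Lemma card_ord_ltn l x : x <= l -> #|[pred y : 'I_l | y < x]| = x.
Proof.
move=> le_x; rewrite -sum1_card.
have := @big_ord_widen _ 0 addn _ l (fun=> 1) le_x.
by rewrite big_const_ord iter_addn_0 mul1n => E; rewrite [RHS]E; apply: eq_bigl.
Qed.

(** * Translation between permutations and words *)

Section CountWords.
Variables (m n : nat) (pi : 'S_m.+1).

Definition word (s : 'S_n) := mkseq (pval s) n.

Lemma pvalE (s : 'S_n) (i : 'I_n) : pval s i = s i.
Proof. by rewrite /pval valK. Qed.

Lemma word_inj : injective word.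
Proof.
move=> s t eq_st; apply/permP => i; apply: ord_inj; rewrite /= -!pvalE.
have := congr1 (fun u => nth 0 u i) eq_st.
by rewrite !nth_mkseq.
Qed.

Lemma word_permutations (s : 'S_n) : word s \in permutations (iota 0 n).
Proof.
rewrite mem_permutations.
have u_w : uniq (word s).
  rewrite map_inj_in_uniq ?iota_uniq // => i j; rewrite !mem_iota /= !add0n.
  move=> lt_i lt_j; rewrite -[i]/(val (Ordinal lt_i)) -[j]/(val (Ordinal lt_j)).
  by rewrite !pvalE => /val_inj/perm_inj ->.
apply: uniq_perm (iota_uniq _ _) _ => //.
have [||] := @uniq_min_size _ _ (iota 0 n) u_w => //.
  move=> x /mapP[i]; rewrite mem_iota => lt_i ->; rewrite mem_iota /=.
  by rewrite -[i]/(val (Ordinal (lt_i : i < n))) pvalE.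
by rewrite size_iota size_mkseq.
Qed.

Lemma perm_words : perm_eq (map word (enum {: 'S_n})) (permutations (iota 0 n)).
Proof.
have u_w : uniq (map word (enum {: 'S_n})).
  by rewrite map_inj_uniq ?enum_uniq //; apply: word_inj.
apply: uniq_perm (permutations_uniq _) _ => //.
have [||] := @uniq_min_size _ _ (permutations (iota 0 n)) u_w => //.
  by move=> _ /mapP[s _ ->]; apply: word_permutations.
by rewrite size_permutations ?iota_uniq // size_iota size_map -cardE card_Sn.
Qed.

Lemma card_ltn_perm (j : 'I_m.+1) : #|[set k | pi k < pi j]| = pi j.
Proof.
transitivity #|[set x : 'I_m.+1 | x < pi j]|.
  rewrite -(card_imset _ (@perm_inj _ pi)); apply: eq_card => x; rewrite inE.
  apply/imsetP/idP => [[k]|lt_x]; first by rewrite inE => lt_k ->.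
  by exists (pi^-1%g x); rewrite ?inE permKV.
by rewrite cardsE card_ord_ltn // ltnW.
Qed.

(** A smaller entry has a strictly smaller rank and equal entries have equal ranks, so the ranks
    decide all comparisons; conversely the comparisons determine the ranks, by [card_ltn_perm]. *)
Lemma occ_st_window (s : 'S_n) i : i + m < n ->
  [forall j : 'I_m.+1, st_window s i j == pi j :> nat] = occ pi (word s) i.
Proof.
move=> lt_i.
have lt_ij (j : 'I_m.+1) : i + j < n by have := ltn_ord j; lia.
have wE (j : 'I_m.+1) : nth 0 (word s) (i + j) = pval s (i + j).
  by rewrite nth_mkseq.
apply/forallP/occP => [H|[_ H] j]; last first.
  rewrite -card_ltn_perm; apply/eqP/eq_card => k.
  by rewrite !inE -!wE H.
have lt_st (j k : 'I_m.+1) : pval s (i + j) < pval s (i + k) -> pi j < pi k.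
  move=> lt_jk; rewrite -(eqP (H j)) -(eqP (H k)) /st_window.
  apply/proper_card/properP; split.
    by apply/subsetP=> l; rewrite !inE => /ltn_trans; apply.
  by exists j; rewrite !inE // ltnn.
split; first by rewrite size_mkseq.
move=> j k; rewrite !wE; case: (ltngtP (pval s (i + j)) (pval s (i + k))).
- by move/lt_st ->.
- by move/lt_st => lt; apply/esym/negbTE; rewrite -leqNgt ltnW.
- move=> eq_jk; rewrite -(eqP (H j)) -(eqP (H k)) /st_window eq_jk.
  by rewrite ltnn.
Qed.

Lemma card_Em (s : 'S_n) : #|Em pi s| = count (occ pi (word s)) (iota 0 n).
Proof.
rewrite -sum1_count -[n in RHS]subn0 -/(index_iota 0 n) -sum1_card big_mkord.
rewrite (big_ord_widen_cond n.+1 (fun i => occ pi (word s) i) (fun=> 1)) //.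
apply: eq_bigl => i; rewrite inE addnS; case: ltnP => [lt_i|le_i] /=.
  by rewrite occ_st_window //; case: ltnP; rewrite ?andbT //; lia.
by rewrite /occ size_mkseq ltnNge le_i.
Qed.

(** Grouping the permutations by their number of occurrences shows that [Wpoly] depends on the
    pattern only through [a_count]. *)
Lemma Wpoly_a_count : ((n`!)%:R *: Wpoly pi n =
  \sum_(k < n.+2) (1 + 'X) ^+ k *+ a_count pi n k)%R.
Proof.
rewrite Wpoly_occ -(perm_big _ perm_words) big_map /= big_enum /=.
under eq_bigr => s _ do rewrite -card_Em.
have lt_Em (s : 'S_n) : #|Em pi s| < n.+2.
  by rewrite ltnS (leq_trans (max_card _)) // card_ord.
rewrite (partition_big (fun s => Ordinal (lt_Em s)) predT) //=.
apply: eq_bigr => k _; rewrite (eq_bigr (fun=> (1 + 'X) ^+ k)%R); last first.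
  by move=> s /eqP <-.
rewrite GRing.sumr_const; congr (_ *+ _)%R.
by apply: eq_card => s; rewrite !inE.
Qed.

End CountWords.

Lemma cWilf_Ipoly m (pi tau : 'S_m.+1) n : strongly_cWilf_equiv pi tau ->
  0 < n -> Ipoly pi n = Ipoly tau n.
Proof.
move=> eq_a; apply: eq_Ipoly => {}n.
apply: (GRing.scalerI (fact_neq0 n)); rewrite !Wpoly_a_count.
by apply: eq_bigr => k _; rewrite eq_a.
Qed.

(** * The irreducible marking whose windows share single letters *)

Section Tiling.
Variables (m k : nat).
Hypothesis m_gt0 : 0 < m.
Notation n := (k * m).+1.

(** The condition [i < k * m] leaves out the last letter, where no window can start. *)
Definition tile : bitseq := mkseq (fun i => (m %| i) && (i < k * m)) n.

Lemma size_tile : size tile = n.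
Proof. exact: size_mkseq. Qed.

Lemma nth_tile i : nth false tile i = (m %| i) && (i < k * m).
Proof.
case: (ltnP i n) => lt_i; first by rewrite nth_mkseq.
by rewrite nth_default ?size_tile // [i < _]ltnNge ltnW // andbF.
Qed.

Lemma nth_tileP i : reflect (exists2 j, j < k & i = j * m) (nth false tile i).
Proof.
rewrite nth_tile; apply: (iffP andP) => [[/dvdnP[j ->]]|[j lt_j ->]].
  by rewrite ltn_pmul2r // => lt_j; exists j.
by rewrite dvdn_mull // ltn_pmul2r.
Qed.

Lemma count_bits_card (b : bitseq) l : size b = l ->
  count id b = #|[set i : 'I_l | nth false b i]|.
Proof.
move=> <-; rewrite -sum1_count (big_nth false) big_mkord cardsE -sum1_card.
by apply: eq_bigl.
Qed.

Definition tile_set : {set 'I_n} := [set inord (j * m) | j : 'I_k].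

Lemma tile_inord (j : 'I_k) : (@inord (k * m) (j * m)) = j * m :> nat.
Proof. by rewrite inordK // ltnS leq_mul2r ltnW ?orbT. Qed.

Lemma card_tile_set : #|tile_set| = k.
Proof.
rewrite card_imset ?card_ord // => j j' /(congr1 (@nat_of_ord _)); rewrite !tile_inord.
by move/eqP; rewrite eqn_pmul2r // => /eqP/val_inj.
Qed.

Lemma tile_setE : [set i : 'I_n | nth false tile i] = tile_set.
Proof.
apply/setP => i; rewrite inE; apply/nth_tileP/imsetP => [[j lt_j ij]|[j _ ->]].
  exists (Ordinal lt_j) => //; apply: val_inj.
  exact: etrans ij (esym (tile_inord (Ordinal lt_j))).
by exists j; rewrite ?tile_inord.
Qed.

Lemma count_tile : count id tile = k.
Proof. by rewrite (count_bits_card size_tile) tile_setE card_tile_set. Qed.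

Lemma irr_tile : irr m tile.
Proof.
rewrite /irr size_tile; apply/andP; split.
  apply/brkP => i /nth_tileP[j lt_j ->]; apply/orP; left.
  by rewrite ltnS addnC -mulSn leq_mul2r lt_j orbT.
apply/hasPn => r; rewrite mem_iota => /andP[r_gt0 lt_r]; apply/brkP => H.
(* Boundary [r] is straddled by the window starting at the last multiple of [m] not exceeding
   [r.-1]. *)
have r1 := divn_eq r.-1 m; have r2 := ltn_pmod r.-1 m_gt0.
have lt_j : r.-1 %/ m < k by rewrite ltn_divLR //; lia.
have /H : nth false tile (r.-1 %/ m * m) by apply/nth_tileP; exists (r.-1 %/ m).
lia.
Qed.

(* The [k] marks of an irreducible [b] cover [m] inner positions each, and there
   are only [k * m] of these, so that no position is covered twice. *)
Lemma irr_tile_uniq (b : bitseq) :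
  size b = n -> irr m b -> count id b = k -> b = tile.
Proof.
move=> sb /andP[]; rewrite sb => /brkP rng /hasPn cov cb.
set S := [set i : 'I_n | nth false b i].
have cardS : #|S| = k by rewrite -(count_bits_card sb).
have rngS (i : 'I_n) : i \in S -> i + m < n.
  by rewrite inE => /rng; rewrite [n <= i]leqNgt ltn_ord orbF.
have covS r : 0 < r < n -> exists2 i : 'I_n, i \in S & i < r <= i + m.
  move=> lt_r; have /cov/allPn[i] : r \in iota 1 n.-1 by rewrite mem_iota; lia.
  rewrite mem_iota sb negb_imply => lt_i /andP[bi lt_ir].
  by exists (Ordinal (lt_i : i < n)); rewrite ?inE //=; lia.
pose f (x : 'I_n * 'I_m) : 'I_n := inord (x.1 + x.2.+1).
have fE i (t : 'I_m) : i \in S -> f (i, t) = i + t.+1 :> nat.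
  by move=> iS; rewrite /f inordK //=; have := rngS i iS; have := ltn_ord t; lia.
(* The domain has [k * m] elements and the image contains all [k * m] nonzero positions. *)
have f_inj : {in setX S setT &, injective f}.
  apply/imset_injP; rewrite eqn_leq leq_imset_card cardsX cardS cardsT card_ord.
  apply: (@leq_trans #|[set~ (ord0 : 'I_n)]|).
    by rewrite cardsC1 card_ord.
  apply/subset_leq_card/subsetP => r; rewrite !inE => r0.
  have [|i iS lt_ir] := covS r; first by rewrite ltn_ord lt0n andbT.
  have lt_t : r - i.+1 < m by lia.
  apply/imsetP; exists (i, Ordinal lt_t); first by rewrite in_setX iS inE.
  by apply: ord_inj; rewrite fE //=; lia.
have once r (i i' : 'I_n) : i \in S -> i' \in S ->
    i < r <= i + m -> i' < r <= i' + m -> i = i'.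
  move=> iS i'S lt_i lt_i'.
  have lt_t : r - i.+1 < m by lia.
  have lt_t' : r - i'.+1 < m by lia.
  suff [] : (i, Ordinal lt_t) = (i', Ordinal lt_t') by [].
  apply: f_inj; rewrite ?in_setX ?iS ?i'S ?inE //.
  by apply: ord_inj; rewrite !fE //=; lia.
have tile_in j : j < k -> (@inord (k * m) (j * m)) \in S.
  elim: j => [|j IH] lt_j.
    have [|i iS lt_i] := covS 1; first by rewrite /= ltnS muln_gt0 m_gt0 lt_j.
    by rewrite (_ : inord _ = i) //; apply: ord_inj; rewrite inordK //=; lia.
  have lt_j' : j < k by lia.
  have jm : (@inord (k * m) (j * m)) = j * m :> nat := tile_inord (Ordinal lt_j').
  have jm1 : j.+1 * m < k * m by rewrite ltn_pmul2r.
  have [|i iS lt_i] := covS (j.+1 * m).+1; first by lia.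
  rewrite (_ : inord _ = i) //; apply: ord_inj; rewrite inordK /=; last by lia.
  apply/eqP; rewrite eqn_leq andbC (_ : i <= j.+1 * m) /=; last by lia.
  (* A mark [i] before [j.+1 * m] would straddle the boundary [j.+1 * m] together with the mark at
     [j * m]. *)
  rewrite leqNgt; apply/negP => lt_ij.
  have /(congr1 val) : i = inord (j * m).
    by apply: (once (j.+1 * m)) => //; [exact: IH | lia | rewrite jm; lia].
  by rewrite /= jm; lia.
have eqS : tile_set = S.
  apply/eqP; rewrite eqEcard cardS card_tile_set leqnn andbT.
  by apply/subsetP => _ /imsetP[j _ ->]; apply: tile_in.
apply: (@eq_from_nth _ false) => [|i lt_i]; first by rewrite size_tile.
rewrite sb in lt_i; have /setP/(_ (Ordinal lt_i)) := eqS.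
by rewrite -tile_setE !inE.
Qed.

Lemma coef_Ipoly (pi : 'S_m.+1) :
  ((Ipoly pi n)`_k = (cnt pi tile)%:R / (n`!)%:R)%R.
Proof.
rewrite /Ipoly coef_sum.
rewrite big_mkcond (bigD1_seq tile) ?bits_uniq ?mem_bits ?size_tile //.
rewrite irr_tile big_seq_cond big1 => [|b].
  by rewrite [X in X = _]GRing.addr0 /wt coefZ coefXn count_tile eqxx
    GRing.mulr1 size_tile.
rewrite mem_bits => /andP[/eqP sb ne]; case: ifP => // irr_b.
rewrite /wt coefZ coefXn; case: eqP => [kb|_]; last by rewrite GRing.mulr0.
by case/eqP: ne; apply: irr_tile_uniq.
Qed.

End Tiling.

Lemma cWilf_cnt_tile m (pi tau : 'S_m.+1) k : 0 < m ->
  strongly_cWilf_equiv pi tau -> cnt pi (tile m k) = cnt tau (tile m k).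
Proof.
move=> m_gt0 eq_pt; have := coef_Ipoly k m_gt0 pi.
rewrite (cWilf_Ipoly eq_pt) // coef_Ipoly // => /(GRing.mulIf _) eq_c.
apply/eqP; rewrite eq_sym -(Num.Theory.eqr_nat rat); apply/eqP/eq_c.
by rewrite GRing.invr_eq0 fact_neq0.
Qed.

(** * Upper bound *)

Lemma uniq_size_card (T : eqType) (F : finType) (f : T -> F) (s : seq T) :
  uniq s -> {in s &, injective f} -> size s <= #|F|.
Proof.
move=> us inj_f; rewrite -(size_map f) cardE uniq_leq_size ?map_inj_in_uniq //.
by move=> x _; rewrite mem_enum.
Qed.

Section UpperBound.
Variables (m k : nat) (pi : 'S_m.+1).
Notation a := (val (pi ord0)).
Notation d := (val (pi ord_max) - val (pi ord0)).
Notation n := (k * m).+1.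
Hypothesis d_gt0 : 0 < d.

Let m_gt0 : 0 < m.
Proof. by have := ltn_ord (pi ord_max); move: d_gt0 => /=; lia. Qed.

Lemma sat_tileP u :
  reflect (forall i, i < k -> occ pi u (i * m)) (sat pi (tile m k) u).
Proof.
apply: (iffP (satP _ _ _)) => [H i lt_i|H i].
  by apply/H/(nth_tileP _ m_gt0); exists i.
by case/(nth_tileP _ m_gt0) => j lt_j ->; apply: H.
Qed.

Definition ppos r : 'I_m.+1 := (pi^-1)%g (inord r).

Lemma ppos0 : ppos a = ord0.
Proof. by rewrite /ppos inord_val permK. Qed.

Lemma ppos_max : ppos (a + d) = ord_max.
Proof. by rewrite /ppos subnKC ?inord_val ?permK //; move: d_gt0 => /=; lia. Qed.

Lemma pposK r : r <= m -> pi (ppos r) = r :> nat.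
Proof. by move=> le_r; rewrite /ppos permKV inordK. Qed.

(* The position of the [j]-th element of the chain going through the shared
   letters of all the occurrences. *)
Definition spine j := j %/ d * m + ppos (a + j %% d).

(** The last letter of an occurrence is the first of the next, so [spine j.+1] can always be read in
    the same occurrence as [spine j]. *)
Lemma spineS j : spine j.+1 = j %/ d * m + ppos (a + (j %% d).+1).
Proof.
have lt_jd := ltn_pmod j d_gt0.
have E : j.+1 = j %/ d * d + (j %% d).+1 by rewrite addnS -divn_eq.
rewrite /spine E.
have [lt|ge] := ltnP (j %% d).+1 d.
  by rewrite divnMDl // modnMDl (divn_small lt) (modn_small lt) addn0.
have eq_d : (j %% d).+1 = d by apply/eqP; rewrite eqn_leq lt_jd.
rewrite eq_d -mulSnr mulnK // modnMl addn0 ppos0 ppos_max addn0.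
by rewrite mulSnr.
Qed.

Lemma spine_step u j : sat pi (tile m k) u -> j < k * d ->
  nth 0 u (spine j) < nth 0 u (spine j.+1).
Proof.
move=> /sat_tileP H lt_j; rewrite spineS.
have /H/occP[_ ->] : j %/ d < k by rewrite ltn_divLR.
have le_m : a + d <= m.
  by rewrite subnKC -ltnS ?ltn_ord //; move: d_gt0; rewrite subn_gt0 => /ltnW.
have le1 : a + (j %% d).+1 <= m.
  by apply: leq_trans le_m; rewrite leq_add2l ltn_pmod.
by rewrite !pposK ?ltn_add2l //; apply: leq_trans le1; rewrite leq_add2l.
Qed.

Lemma spine_lt u i j : sat pi (tile m k) u -> i < j -> j <= k * d ->
  nth 0 u (spine i) < nth 0 u (spine j).
Proof.
move=> su; elim: j => // j IH; rewrite ltnS leq_eqVlt => /orP[/eqP ->|lt_ij] lt_j.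
  exact: spine_step.
by apply: ltn_trans (IH lt_ij (ltnW lt_j)) (spine_step su lt_j).
Qed.

Lemma spine_ltn j : j <= k * d -> spine j < n.
Proof.
rewrite ltnS leq_eqVlt => /orP[/eqP ->|lt_j].
  by rewrite /spine mulnK // modnMl addn0 ppos0 addn0.
have : j %/ d < k by rewrite ltn_divLR.
have := ltn_ord (ppos (a + j %% d)); rewrite /spine.
by move: (_ %/ _) (ppos _) => i p; nia.
Qed.

Let L := [seq spine j | j <- iota 0 (k * d).+1].
Let C := [seq p <- iota 0 n | p \notin L].

Lemma spine_sorted u : sat pi (tile m k) u -> sorted ltn [seq nth 0 u p | p <- L].
Proof.
move=> su; rewrite -map_comp; apply: (@homo_sorted_in _ _ (gtn (k * d).+1) _ ltn).
- by move=> i j lt_i lt_j lt_ij; apply: spine_lt.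
- by apply/allP => i; rewrite mem_iota.
- exact: iota_ltn_sorted.
Qed.

(** The values of [u] increase strictly along the chain, which forces the chain positions [L] to be
    distinct. *)
Lemma perm_spine_compl u : sat pi (tile m k) u -> perm_eq (L ++ C) (iota 0 n).
Proof.
move=> su; have uL : uniq L.
  apply: (@map_uniq _ _ (nth 0 u)); apply: (sorted_uniq ltn_trans ltnn).
  exact: spine_sorted.
rewrite perm_sym -(perm_filterC (mem L)) perm_cat2r.
apply: uniq_perm; rewrite ?filter_uniq ?iota_uniq // => p.
rewrite mem_filter; apply: andb_idr => /mapP[j]; rewrite !mem_iota => lt_j ->.
by rewrite spine_ltn.
Qed.

Lemma cnt_tile_le : cnt pi (tile m k) <= n ^ (k * (m - d)).
Proof.
set G := [seq u <- permutations (iota 0 n) | sat pi (tile m k) u].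
have -> : cnt pi (tile m k) = size G by rewrite /cnt size_tile size_filter.
(* With no such word the bound is trivial; otherwise [u0] provides the distinctness of the chain
   positions. *)
case defG: G => [//|u0 G0]; rewrite -defG.
have su0 : sat pi (tile m k) u0.
  have : u0 \in G by rewrite defG mem_head.
  by rewrite mem_filter => /andP[].
have pLC := perm_spine_compl su0.
have szC : size C = k * (m - d).
  have := perm_size pLC; rewrite size_cat size_map !size_iota addSn => -[E].
  by rewrite (mulnBr k m d) -E addKn.
(* A word is encoded by its values off the chain. *)
pose f (u : seq nat) : {ffun 'I_(size C) -> 'I_n} :=
  [ffun t : 'I_(size C) => inord (nth 0 u (nth 0 C t))].
rewrite -szC -[X in _ <= X ^ _]card_ord -[X in _ <= _ ^ X]card_ord -card_ffun.
apply: (@uniq_size_card _ _ f); first by rewrite filter_uniq ?permutations_uniq.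
have permG u : u \in G ->
    [/\ sat pi (tile m k) u, size u = n & perm_eq u (iota 0 n)].
  rewrite mem_filter mem_permutations => /andP[-> pu].
  by rewrite (perm_size pu) size_iota.
have permLC u : u \in G ->
    perm_eq (map (nth 0 u) L ++ map (nth 0 u) C) (iota 0 n).
  move=> /permG[_ szu pu]; rewrite -map_cat (permPl (perm_map _ pLC)) -szu.
  by rewrite -/(mkseq _ _) mkseq_nth szu.
have ltG u p : u \in G -> p < n -> nth 0 u p < n.
  move=> /permG[_ szu pu] lt_p; have := mem_nth 0 (_ : p < size u).
  by rewrite (perm_mem pu) mem_iota szu; apply.
move=> u v uG vG eq_f; have [su szu pu] := permG u uG.
have [sv szv pv] := permG v vG.
have eqC : map (nth 0 u) C = map (nth 0 v) C.
  apply: (@eq_from_nth _ 0); rewrite ?size_map // => t lt_t.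
  rewrite !(nth_map 0) //; move/ffunP/(_ (Ordinal lt_t))/(congr1 val): eq_f.
  have ltC : nth 0 C t < n.
    by have := mem_nth 0 lt_t; rewrite mem_filter mem_iota => /andP[].
  by rewrite !ffunE /= !inordK //; apply: ltG.
(* The letters left for the chain are the same in [u] and [v], and their order along it is
   forced. *)
have eqL : map (nth 0 u) L = map (nth 0 v) L.
  apply: (irr_sorted_eq ltn_trans ltnn); try exact: spine_sorted.
  apply: perm_mem; rewrite -(perm_cat2r (map (nth 0 u) C)) {2}eqC.
  by rewrite (permPl (permLC u uG)) perm_sym permLC.
apply: (@eq_from_nth _ 0); first by rewrite szu.
move=> p; rewrite szu => lt_p.
have: p \in L ++ C by rewrite (perm_mem pLC) mem_iota.
have /eq_in_map : map (nth 0 u) (L ++ C) = map (nth 0 v) (L ++ C).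
  by rewrite !map_cat eqL eqC.
by move=> E /E.
Qed.

End UpperBound.

(** * Lower bound *)

Lemma card_le_count (F : finType) (T : eqType) (A : {pred F}) (f : F -> T)
    (P : pred T) (s : seq T) :
  {in A &, injective f} -> {in A, forall x, f x \in s /\ P (f x)} ->
  #|A| <= count P s.
Proof.
move=> inj_f fP; rewrite -size_filter cardE -(size_map f) uniq_leq_size //.
  rewrite map_inj_in_uniq ?enum_uniq // => x y; rewrite !mem_enum.
  exact: inj_f.
move=> y /mapP[x]; rewrite mem_enum => Ax ->; rewrite mem_filter.
by case: (fP x Ax) => -> ->.
Qed.

Lemma prod_divn_mul (f : nat -> nat -> nat) k l : 0 < l ->
  \prod_(0 <= p < k * l) f (p %/ l) (p %% l) =
  \prod_(0 <= i < k) \prod_(0 <= t < l) f i t.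
Proof.
move=> l_gt0; rewrite big_nat_mul; apply: eq_bigr => i _.
rewrite mulSn addnC -{1}[i * l]add0n big_addn addKn; apply: eq_big_nat => t /andP[_ lt_t].
by rewrite addnC divnMDl // modnMDl divn_small // modn_small // addn0.
Qed.

Section LowerBound.
Variables (m k : nat) (pi : 'S_m.+1).
Notation a := (val (pi ord0)).
Notation e := (val (pi ord_max)).
Notation n := (k * m).+1.
Notation M := m.+1.
Hypothesis lt_ae : a < e.

Let m_gt0 : 0 < m.
Proof. by have := ltn_ord (pi ord_max); move: lt_ae => /=; lia. Qed.

(** A shared letter is read as the first of its block, with rank [a], never as the last of the
    previous one. *)
Definition prank p := val (pi (inord (p %% m))).

(* A word of length [n] is encoded by levels and offsets: the shared letter at
   position [i * m] has level [i] and the largest offset, and the letters below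
   (above) both shared letters of the [i]-th occurrence may choose their level in
   a window of size [gap p + 1], whose lower end is [base p]. *)
Definition gap p :=
  if prank p < a then (p %/ m) %/ M
  else if e < prank p then (k.-1 - p %/ m) %/ M else 0.

Definition base p :=
  if p %% m == 0 then p %/ m
  else if prank p < a then prank p * ((p %/ m) %/ M)
  else if prank p <= e then (p %/ m).+1
  else (p %/ m).+2 + (prank p - e.+1) * ((k.-1 - p %/ m) %/ M).

(** The value [k * M] exceeds the offsets of all unshared letters, so the shared letter of level [j]
    comes last in that level. *)
Definition off p := if p %% m == 0 then k * M else p %/ m * M + prank p.

Definition lval (c : nat -> nat) p := (base p + c p) * (k * M).+1 + off p.

Lemma prank_ltn p : prank p < M.
Proof. exact: ltn_ord. Qed.

Lemma ltn_block p : p < n -> p %% m != 0 -> p %/ m < k.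
Proof.
move=> lt_p nz; rewrite ltn_divLR // ltn_neqAle -ltnS lt_p andbT.
by apply/eqP => E; rewrite E modnMl in nz.
Qed.

Lemma off_nonspine p : p < n -> p %% m != 0 -> off p < k * M.
Proof.
move=> lt_p nz; rewrite /off (negbTE nz).
have := ltn_block lt_p nz; have := prank_ltn p.
by move: (p %/ m) (prank p) => i r; nia.
Qed.

Lemma off_ltn p : p < n -> off p < (k * M).+1.
Proof.
move=> lt_p; case: (altP (p %% m =P 0)) => [z|nz]; first by rewrite /off z.
exact/ltnW/off_nonspine.
Qed.

Lemma prank_spine p : p %% m = 0 -> prank p = a.
Proof. by rewrite /prank => ->; congr (val (pi _)); apply: ord_inj; rewrite inordK. Qed.

Lemma gap_spine p : p %% m = 0 -> gap p = 0.
Proof. by move=> z; rewrite /gap prank_spine // ltnn ltnNge ltnW. Qed.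

Lemma off_block_inj p q : p < n -> q < n -> off p = off q ->
  p %/ m = q %/ m -> p = q.
Proof.
move=> lt_p lt_q eq_off eq_d.
case: (altP (p %% m =P 0)) => [zp|nzp]; case: (altP (q %% m =P 0)) => [zq|nzq].
- by rewrite (divn_eq p m) (divn_eq q m) zp zq eq_d.
- by have := off_nonspine lt_q nzq; rewrite -eq_off /off zp eqxx ltnn.
- by have := off_nonspine lt_p nzp; rewrite eq_off /off zq eqxx ltnn.
have : prank p = prank q.
  by move: eq_off; rewrite /off (negbTE nzp) (negbTE nzq) eq_d => /addnI.
have lt_mod r : r %% m < m.+1 by rewrite ltnW // ltnS ltn_pmod.
move/val_inj/perm_inj/(congr1 val); rewrite /= !inordK // => eq_m.
by rewrite (divn_eq p m) (divn_eq q m) eq_m eq_d.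
Qed.

(* Level and offset of the letter of rank [r] in the [i]-th occurrence. *)
Variant block_spec i r l o : Prop :=
| BlockLow x of r < a & x <= i %/ M & l = r * (i %/ M) + x & o = i * M + r
| BlockFirst of r = a & l = i & o = k * M
| BlockMid of a < r < e & l = i.+1 & o = i * M + r
| BlockLast of r = e & l = i.+1 & o = k * M
| BlockHigh x of e < r & x <= (k.-1 - i) %/ M
    & l = i.+2 + (r - e.+1) * ((k.-1 - i) %/ M) + x & o = i * M + r.

(** Low windows are stacked end to end up to level [i] at most, high ones from level [i.+2] on.
    Where levels tie, the offset decides: it grows with the rank of unshared letters and is largest
    at shared ones. *)
Lemma block_spec_lt i r l o r' l' o' : i < k -> r < r' -> r' <= m ->
  block_spec i r l o -> block_spec i r' l' o' ->
  l <= l' /\ ((l < l') || (o < o')).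
Proof.
move=> lt_i lt_r le_r' S S'.
have off_lt x : x <= m -> i * M + x < k * M.
  move=> le_x; apply: (@leq_trans (i.+1 * M)); last by rewrite leq_mul2r lt_i orbT.
  by rewrite mulSnr ltn_add2l.
have off_lt_r : i * M + r < k * M by apply: off_lt; lia.
have le_am : a <= m by rewrite -ltnS ltn_ord.
(* The division by [M] in [gap] makes all [a] low windows fit, since [a] is less than [M]. *)
have le_v : a * (i %/ M) <= i.
  apply: leq_trans (leq_divM i M); rewrite mulnC leq_mul2l; apply/orP; right.
  exact: ltnW.
have mul_lt x y w : x < y -> x * w + w <= y * w.
  by move=> lt_xy; rewrite -mulSnr leq_mul2r lt_xy orbT.
move: (mul_lt r r' (i %/ M)) (mul_lt r a (i %/ M)).
move: (mul_lt (r - e.+1) (r' - e.+1) ((k.-1 - i) %/ M)).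
case: S => [x h1 h2 -> ->|h1 -> ->|h1 -> ->|h1 -> ->|x h1 h2 -> ->];
case: S' => [x' h1' h2' -> ->|h1' -> ->|h1' -> ->|h1' -> ->|x' h1' h2' -> ->];
move: le_v off_lt_r {mul_lt off_lt le_am} lt_ae lt_r h1 h1';
try move: h2; try move: h2';
move: (val (pi ord0)) (val (pi ord_max)) (k * M) (i * M) (i %/ M) ((k.-1 - i) %/ M)
  => /= A E kM iM v w; lia.
Qed.

(** * The word built from a choice of levels *)

Section Choice.
Variable c : nat -> nat.
Hypothesis le_c : forall p, p < n -> c p <= gap p.

Lemma c_spine p : p < n -> p %% m = 0 -> c p = 0.
Proof. by move=> lt_p z; have := le_c lt_p; rewrite gap_spine // leqn0 => /eqP. Qed.

Lemma lval_lt p q : p < n -> q < n ->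
  base p + c p <= base q + c q ->
  (base p + c p < base q + c q) || (off p < off q) -> lval c p < lval c q.
Proof.
move=> lt_p lt_q le_pq /orP lt_pq; rewrite /lval.
have := off_ltn lt_p; have := off_ltn lt_q; move: le_pq lt_pq.
move: (base p + c p) (base q + c q) (off p) (off q) (k * M).+1.
by move=> x y o o' B le [lt|lt]; nia.
Qed.

(** Division recovers level and offset. The level identifies a shared letter, the offset an unshared
    one. *)
Lemma lval_inj p q : p < n -> q < n -> lval c p = lval c q -> p = q.
Proof.
move=> lt_p lt_q eq_pq.
have := edivn_eq (base p + c p) (off_ltn lt_p).
rewrite -/(lval c p) eq_pq /lval edivn_eq ?off_ltn // => -[eq_l eq_o].
apply: off_block_inj => //.
case: (altP (p %% m =P 0)) => [zp|nzp]; case: (altP (q %% m =P 0)) => [zq|nzq].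
- by move: eq_l; rewrite /base zp zq !c_spine // !addn0 => ->.
- by have := off_nonspine lt_q nzq; rewrite eq_o /off zp eqxx ltnn.
- by have := off_nonspine lt_p nzp; rewrite -eq_o /off zq eqxx ltnn.
have := prank_ltn p; have := prank_ltn q; move: eq_o.
rewrite /off (negbTE nzp) (negbTE nzq) => E lt1 lt2.
have := congr1 (fun x => x %/ M) E; rewrite !divnMDl //.
rewrite (divn_small lt1) (divn_small lt2) !addn0.
by move->.
Qed.

Lemma ltn_block_pos i (t : 'I_M) : i < k -> i * m + t < n.
Proof.
move=> lt_i; rewrite ltnS (@leq_trans (i.+1 * m)) ?leq_mul2r ?lt_i ?orbT //.
by rewrite mulSnr leq_add2l -ltnS.
Qed.

Lemma block_specP i (t : 'I_M) : i < k ->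
  block_spec i (pi t) (base (i * m + t) + c (i * m + t)) (off (i * m + t)).
Proof.
move=> lt_i; have lt_p := ltn_block_pos t lt_i.
case: (altP (t =P ord0)) => [E0|n0].
  have Ep : i * m + t = i * m by rewrite E0 /= addn0.
  move: lt_p; rewrite Ep => lt_p; apply: BlockFirst.
  - by rewrite E0.
  - by rewrite /base modnMl eqxx mulnK // c_spine ?addn0 ?modnMl.
  - by rewrite /off modnMl.
(* The last letter of the occurrence sits at position [i.+1 * m] and is encoded as the first of the
   next block. *)
case: (altP (t =P ord_max)) => [Em|nm].
  have Ep : i * m + t = i.+1 * m by rewrite Em mulSnr.
  move: lt_p; rewrite Ep => lt_p; apply: BlockLast.
  - by rewrite Em.
  - by rewrite /base modnMl eqxx mulnK // c_spine ?addn0 ?modnMl.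
  - by rewrite /off modnMl.
have lt_t : t < m.
  rewrite ltn_neqAle -ltnS ltn_ord andbT; apply: contraNneq nm => E.
  exact/eqP/ord_inj.
have E : (i * m + t) %% m = t by rewrite modnMDl modn_small.
have Ed : (i * m + t) %/ m = i by rewrite divnMDl // divn_small // addn0.
have Er : prank (i * m + t) = pi t by rewrite /prank E inord_val.
have nt : (t == 0 :> nat) = false by apply/negbTE.
have na : pi t != a :> nat by apply: contraNneq n0 => /ord_inj/perm_inj ->.
have ne : pi t != e :> nat by apply: contraNneq nm => /ord_inj/perm_inj ->.
have := le_c lt_p; rewrite /gap /base /off Ed E Er nt.
move: na ne; case: (ltngtP (pi t) a) => // lta _.
  by move=> _ le; apply: BlockLow le _ _.
case: (ltngtP (pi t) e) => // lte _ le; last by apply: BlockHigh le _ _.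
move: le; rewrite leqn0 => /eqP ->; rewrite addn0.
by apply: BlockMid => //; rewrite lta.
Qed.

Lemma lval_block i (j l : 'I_M) : i < k ->
  (lval c (i * m + j) < lval c (i * m + l)) = (pi j < pi l).
Proof.
move=> lt_i.
have lt (x y : 'I_M) : pi x < pi y -> lval c (i * m + x) < lval c (i * m + y).
  move=> lt_xy; have le_y : pi y <= m by rewrite -ltnS.
  have [] := block_spec_lt lt_i lt_xy le_y (block_specP x lt_i) (block_specP y lt_i).
  by apply: lval_lt; apply: ltn_block_pos.
case: (ltngtP (pi j) (pi l)) => [/lt -> //|/lt gt|/ord_inj/perm_inj ->].
  by apply/negbTE; rewrite -leqNgt ltnW.
by rewrite ltnn.
Qed.

Definition lword := mkseq (lval c) n.

Lemma lword_uniq : uniq lword.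
Proof.
rewrite map_inj_in_uniq ?iota_uniq // => p q; rewrite !mem_iota.
exact: lval_inj.
Qed.

Lemma sat_lword : sat pi (tile m k) lword.
Proof.
apply/sat_tileP; first by rewrite subn_gt0.
move=> i lt_i; apply/occP; split=> [|j l].
  by have := ltn_block_pos ord_max lt_i; rewrite size_mkseq.
by rewrite !nth_mkseq ?ltn_block_pos // lval_block.
Qed.

(** Comparison with the shared letters reveals the level of [p], which makes the choice recoverable
    from the relative order. *)
Lemma lval_spine j p : j <= k -> p < n -> p %% m != 0 ->
  (lval c (j * m) < lval c p) = (j < base p + c p).
Proof.
move=> le_j lt_p nz.
have lt_jm : j * m < n by rewrite ltnS leq_mul2r le_j orbT.
have := off_nonspine lt_p nz; rewrite /lval.
rewrite [base (j * m)]/base [off (j * m)]/off modnMl eqxx mulnK // c_spine ?modnMl //.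
rewrite addn0; move: (base p + c p) (off p) (k * M) => l o B lt_o.
by apply/idP/idP; nia.
Qed.

Lemma level_le p : p < n -> p %% m != 0 -> base p + c p <= k.+1.
Proof.
move=> lt_p nz; have lt_i := ltn_block lt_p nz.
have := le_c lt_p; have := prank_ltn p; rewrite /gap /base (negbTE nz).
have v1 := leq_divM (p %/ m) M; have v2 := leq_divM (k.-1 - p %/ m) M.
move: (prank p) (p %/ m) ((k.-1 - p %/ m) %/ M) lt_i v1 v2 => r i w lt_i v1 v2.
move: (i %/ M) v1 => v v1 lt_r; case: ifP => _; first by nia.
by case: (ltnP e r) => _; nia.
Qed.

End Choice.

Definition level_choice : {pred {ffun 'I_n -> 'I_n}} :=
  family (fun p : 'I_n => [pred x : 'I_n | x <= gap p]).

Lemma gap_le p : p < n -> gap p <= k * m.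
Proof.
move=> lt_p; have le_k : p %/ m <= k by rewrite -[leqRHS](mulnK k m_gt0) leq_div2r.
have le_km : k <= k * m by rewrite leq_pmulr.
rewrite /gap; case: ifP => _; last case: ifP => // _.
  by rewrite (leq_trans (leq_div _ _)) // (leq_trans le_k).
rewrite (leq_trans (leq_div _ _)) // (leq_trans (leq_subr _ _)) //.
exact: leq_trans (leq_pred k) le_km.
Qed.

Lemma card_level_choice : #|level_choice| = \prod_(0 <= p < n) (gap p).+1.
Proof.
rewrite big_mkord card_family foldrE big_map big_enum /=; apply: eq_bigr => p _.
by rewrite -[RHS](@card_ord_ltn n) ?ltnS ?gap_le.
Qed.

Lemma card_level_choice_le : #|level_choice| <= cnt pi (tile m k).
Proof.
pose cf (c : {ffun 'I_n -> 'I_n}) p := val (c (inord p)).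
have cfP c : c \in level_choice -> forall p, p < n -> cf c p <= gap p.
  by move=> /familyP cc p lt_p; have := cc (inord p); rewrite inE inordK.
pose st c := map (rk (lword (cf c))) (lword (cf c)).
rewrite /cnt size_tile; apply: (@card_le_count _ _ _ st) => [c c' cc cc' eq_st|c cc].
  apply/ffunP => p; apply: ord_inj.
  have cE (f : {ffun 'I_n -> 'I_n}) : f p = cf f p :> nat by rewrite /cf inord_val.
  rewrite !cE; have lt_p := ltn_ord p; have cP := cfP _ cc; have c'P := cfP _ cc'.
  case: (altP (p %% m =P 0)) => [z|nz].
    by rewrite (c_spine cP lt_p z) (c_spine c'P lt_p z).
  have cmp f q q' : f \in level_choice -> q < n -> q' < n ->
      (nth 0 (st f) q < nth 0 (st f) q') = (lval (cf f) q < lval (cf f) q').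
    move=> ff lt_q lt_q'.
    have E x : x < n -> nth 0 (st f) x = rk (lword (cf f)) (lval (cf f) x).
      by move=> lt_x; rewrite (nth_map 0) ?size_mkseq // nth_mkseq.
    by rewrite !E // ltn_rk // map_f ?mem_iota.
  have eq_lt j : j <= k -> (j < base p + cf c p) = (j < base p + cf c' p).
    move=> le_j; have lt_jm : j * m < n by rewrite ltnS leq_mul2r le_j orbT.
    by rewrite -!lval_spine // -!cmp // eq_st.
  have := level_le cP lt_p nz; have := level_le c'P lt_p nz.
  move=> le1 le2; apply/eqP; rewrite -(eqn_add2l (base p)).
  (* Of two different levels the smaller is at most [k], so the shared letter of that level
     separates them. *)
  case: ltngtP => // lt.
    by have := eq_lt (base p + cf c p); rewrite lt ltnn; lia.
  by have := eq_lt (base p + cf c' p); rewrite lt ltnn; lia.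
have cP := cfP _ cc; have uw := lword_uniq cP; split.
  by rewrite mem_permutations; have := perm_rk uw; rewrite size_mkseq.
rewrite sat_map ?sat_lword //; exact: ltn_rk.
Qed.

Lemma prod_gap : \prod_(0 <= p < n) (gap p).+1 =
  (\prod_(0 <= i < k) (i %/ M).+1) ^ (m - (e - a)).
Proof.
pose g i r := if r < a then (i %/ M).+1
  else if e < r then ((k.-1 - i) %/ M).+1 else 1.
rewrite big_nat_recr //= gap_spine ?modnMl // muln1.
transitivity (\prod_(0 <= i < k) \prod_(0 <= t < m) g i (pi (inord t))).
  rewrite -(prod_divn_mul (fun i t => g i (pi (inord t)))) //.
  by apply: eq_bigr => p _; rewrite /gap /g /prank; case: ifP => // _; case: ifP.
transitivity (\prod_(0 <= i < k) ((i %/ M).+1 ^ a * ((k.-1 - i) %/ M).+1 ^ (m - e))).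
  apply: eq_bigr => i _.
  (* Including the last letter of the occurrence, whose factor is 1, lets the product run over all
     ranks. *)
  transitivity (\prod_(t < M) g i (pi t)).
    rewrite big_mkord big_ord_recr /= [X in _ * X](_ : _ = 1).
      rewrite muln1; apply: eq_bigr => t _; congr (g i (pi _)).
      by apply: ord_inj; rewrite inordK // ltnW // ltnS.
    by rewrite /g ltnn ltnNge ltnW.
  transitivity (\prod_(r < M) g i r).
    by rewrite [RHS](reindex_inj (@perm_inj _ pi)).
  rewrite -(big_mkord predT (g i)) (@big_cat_nat _ _ _ a) //=; last by rewrite ltnW.
  rewrite (@big_cat_nat _ _ _ e.+1 a) //=; last by rewrite ltnW // ltnW.
  rewrite (eq_big_nat _ _ (F2 := fun=> (i %/ M).+1)); last first.
    by move=> r /andP[_ lt_r]; rewrite /g lt_r.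
  rewrite [X in _ * (X * _)]big_nat_cond [X in _ * (X * _)]big1; last first.
    move=> r; rewrite andbT ltnS => /andP[le1 le2].
    by rewrite /g ltnNge le1 ltnNge le2.
  rewrite mul1n.
  rewrite [X in _ * X](eq_big_nat _ _ (F2 := fun=> ((k.-1 - i) %/ M).+1)); last first.
    by move=> r /andP[lt_r _]; rewrite /g lt_r ltnNge ltnW // (leq_trans _ lt_r) // ltnW.
  by rewrite !prod_nat_const_nat subn0 subSS.
rewrite big_split /= -!(big_morph (expn^~ _) (fun x y => expnMn x y _) (exp1n _)).
(* Reversing the order of the occurrences exchanges the window sizes above and below the chain. *)
have -> : \prod_(0 <= i < k) ((k.-1 - i) %/ M).+1 = \prod_(0 <= i < k) (i %/ M).+1.
  rewrite big_nat_rev /=; apply: eq_big_nat => i /andP[_ lt_i].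
  by congr ((_ %/ _).+1); lia.
rewrite -expnD; congr (_ ^ _); have := ltn_ord (pi ord_max); move: lt_ae => /=; lia.
Qed.

End LowerBound.

(** * Comparison of growth rates *)

(** Among [K * m.+1] occurrences each quotient [i %/ m.+1] appears [m.+1] times, so the product in
    [prod_gap] is a power of [K]!. *)
Lemma cnt_tile_ge m K (pi : 'S_m.+1) : val (pi ord0) < val (pi ord_max) ->
  K`! ^ (m.+1 * (m - (val (pi ord_max) - val (pi ord0))))
    <= cnt pi (tile m (K * m.+1)).
Proof.
move=> lt_ae; apply: leq_trans (card_level_choice_le (K * m.+1) lt_ae).
rewrite card_level_choice // prod_gap // expnM leq_eqVlt; apply/orP; left; apply/eqP.
congr (_ ^ _); rewrite (prod_divn_mul (fun i _ => i.+1)) //.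
rewrite fact_prod big_add1 /= (big_morph (expn^~ _) (fun x y => expnMn x y _) (exp1n _)).
by apply: eq_bigr => i _; rewrite prod_nat_const_nat subn0.
Qed.

Lemma bin_le_expn n j : 'C(n, j) <= 2 ^ n.
Proof.
elim: n j => [|n IH] [|j] //; first by rewrite bin0 expn_gt0.
by rewrite binS expnS mul2n -addnn leq_add.
Qed.

Lemma expn_le_ffact K j : K ^ j <= (K + j) ^_ j.
Proof.
elim: j => // j IH; rewrite addnS ffactSS expnS leq_mul // -addnS.
exact: leq_addr.
Qed.

(** The falling factorial of [K + K] of length [K] is a central binomial coefficient times [K]!. *)
Lemma expn_le_fact K : K ^ K <= 4 ^ K * K`!.
Proof.
apply: leq_trans (expn_le_ffact K K) _; rewrite -bin_ffact leq_mul2r.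
by rewrite (leq_trans (bin_le_expn _ _)) ?orbT // addnn -mul2n expnM.
Qed.

Lemma fact_expn_large M s : 0 < M ->
  exists2 K, 0 < K & (M ^ 2 * K) ^ (K * s) < K`! ^ s.+1.
Proof.
(* Failure of the inequality would give [K ^ s.+1 <= D * K ^ s], hence [K <= D]. *)
move=> M_gt0; pose D := 4 ^ s.+1 * (M ^ 2) ^ s; exists D.+1 => //.
set K := D.+1; rewrite ltnNge; apply/negP => le.
have : (K ^ s.+1) ^ K <= (D * K ^ s) ^ K.
  rewrite -expnM mulnC expnM.
  apply: (@leq_trans ((4 ^ K * K`!) ^ s.+1)); first by rewrite leq_exp2r ?expn_le_fact.
  rewrite expnMn -expnM mulnC.
  apply: (@leq_trans ((M ^ 2 * K) ^ (K * s) * 4 ^ (K * s.+1))).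
    by rewrite leq_mul2r le orbT.
  rewrite (mulnC K s) (mulnC K s.+1) !expnM -expnMn leq_exp2r //.
  by rewrite [(_ * K) ^ s]expnMn /D mulnC mulnA.
rewrite leq_exp2r // expnS leq_mul2r expn_eq0 /= => le_KD.
by move: le_KD; rewrite /K ltnn.
Qed.

Lemma cWilf_spread_le m (pi tau : 'S_m.+1) :
  val (pi ord0) < val (pi ord_max) -> val (tau ord0) < val (tau ord_max) ->
  strongly_cWilf_equiv pi tau ->
  val (tau ord_max) - val (tau ord0) <= val (pi ord_max) - val (pi ord0).
Proof.
move=> lt_pi lt_tau eq_pt; rewrite leqNgt; apply/negP => lt_d.
have m_gt0 : 0 < m by have := ltn_ord (pi ord_max); move: lt_pi => /=; lia.
set s := m - (val (tau ord_max) - val (tau ord0)).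
have lt_s : s < m - (val (pi ord_max) - val (pi ord0)).
  rewrite ltn_sub2l //; apply: leq_trans lt_d _.
  by rewrite (leq_trans (leq_subr _ _)) // -ltnS ltn_ord.
have [K K_gt0] := @fact_expn_large m.+1 s isT; rewrite ltnNge => /negP[].
(* The exponent [m.+1] matches the choice of [K * m.+1] occurrences in [cnt_tile_ge]. *)
rewrite -(@leq_exp2r _ _ m.+1) // -!expnM.
apply: leq_trans (_ : K`! ^ (m.+1 * (m - (val (pi ord_max) - val (pi ord0)))) <= _).
  by rewrite leq_pexp2l ?fact_gt0 // mulnC leq_mul2l lt_s orbT.
apply: leq_trans (cnt_tile_ge K lt_pi) _; rewrite (cWilf_cnt_tile _ _ eq_pt) //.
apply: leq_trans (cnt_tile_le _ _) _; first by rewrite subn_gt0.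
rewrite -/s (_ : K * s * m.+1 = K * m.+1 * s); last by rewrite mulnAC.
(* Since [K] is positive, the word length [K * m.+1 * m + 1] is at most [m.+1 ^ 2 * K]. *)
case: (posnP (K * m.+1 * s)) => [-> // |e_gt0]; rewrite leq_exp2r //; nia.
Qed.

Theorem theorem1p9 (m : nat) (pi tau : 'S_m.+1) :
  standard_form pi -> standard_form tau ->
  strongly_cWilf_equiv pi tau ->
  val (pi ord_max) - val (pi ord0) = val (tau ord_max) - val (tau ord0).
Proof.
move=> [lt_pi _] [lt_tau _] eq_pt; apply/eqP; rewrite eqn_leq.
by rewrite !cWilf_spread_le // => n k; rewrite eq_pt.
Qed.
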